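(* Let $k\ge0$ and $n\ge k+2$ be integers, $\mathcal{Z}\in\mathrm{Mat}_{n,k+2}^{>0}$ and $Y\in\mathrm{Gr}_{k,k+2}^{\mathrm{wcb}}$. 1. We have $w_{n,k,2}(Y,\mathcal{Z})\le\left\lfloor\frac{k+1}{2}\right\rfloor$. 2. If $w_{n,k,2}(Y,\mathcal{Z})=\left\lfloor\frac{k+1}{2}\right\rfloor$ and $Y$ satisfies the coarse boundary conditions, i.e. $\langle Y,i,i+1\rangle\ge0$ for all $1\le i\le n-1$ and $(-1)^{k+1}\langle Y,n,1\rangle\ge0$, then $Y\in\mathcal{A}_{n,k,2}$.
   Context: $\mathrm{Gr}_{k,n}$ is the real Grassmannian of $k$-planes in $\mathbb{R}^n$, a point being represented by a $k\times n$ matrix whose rows span it; $\mathrm{Gr}_{k,n}^{\ge0}$ is the set of points having a representative all of whose maximal minors are $\ge0$. $\mathrm{Mat}_{n,k+2}^{>0}$ is the set of real $n\times(k+2)$ matrices all of whose maximal minors (rows in increasing order) are positive; the rows of $\mathcal{Z}$ are $\mathcal{Z}_1,\dots,\mathcal{Z}_n\in\mathbb{R}^{k+2}$. The amplituhedron $\mathcal{A}_{n,k,2}\subset\mathrm{Gr}_{k,k+2}$ is the image of $\mathrm{Gr}_{k,n}^{\ge0}$ under the map sending the point represented by $C$ to the point represented by $C\mathcal{Z}$. For $Y\in\mathrm{Gr}_{k,k+2}$ with a representative with rows $Y_1,\dots,Y_k$, the twistor coordinates are $\langle Y,i,j\rangle:=\det(Y_1,\dots,Y_k,\mathcal{Z}_i,\mathcal{Z}_j)$;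 they are defined up to a common nonzero factor. ''$Y$ satisfies the coarse boundary conditions'' means that the inequalities hold for some choice of representative. $\mathrm{Gr}_{k,k+2}^{\mathrm{wcb}}$ is the set of $Y\in\mathrm{Gr}_{k,k+2}$ such that $\langle Y,i,i+1\rangle\ne0$ for $1\le i\le n-1$ and $\langle Y,n,1\rangle\neq0$. Winding number. Let $V_Y=\mathbb{R}^{k+2}/Y\simeq\mathbb{R}^2$, $\pi_Y$ the quotient map, $Z_i=\pi_Y(\mathcal{Z}_i)$. A representative of $Y$ orients $V_Y$: $(\pi_Y(f_1),\pi_Y(f_2))$ is positive iff $\det(Y_1,\dots,Y_k,f_1,f_2)>0$. For $Y\in\mathrm{Gr}_{k,k+2}^{\mathrm{wcb}}$ the closed polygon $P(Y,\mathcal{Z})$ formed by the oriented segments $[Z_1,Z_2],[Z_2,Z_3],\dots,[Z_{n-1},Z_n],[Z_n,Z_1]$ avoids the origin, and $w_{n,k,2}(Y,\mathcal{Z})\in\mathbb{Z}$ is its winding number around the origin of $V_Y$ (the degree of $x\mapsto x/\|x\|$ from $P(Y,\mathcal{Z})$ to the unit circle), with respect to the orientation of $V_Y$ given by the representative of $Y$. In part 1 the representative is arbitrary; in part 2 the winding number and the coarse boundary conditions are taken with the same representative. *)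

(* Defs.v *)
From HB Require Import structures.
From mathcomp Require Import all_boot all_order all_algebra.
From mathcomp Require Import all_classical all_reals all_analysis.

Set Implicit Arguments.
Unset Strict Implicit.
Unset Printing Implicit Defensive.

Import Order.TTheory GRing.Theory Num.Theory.
Import numFieldNormedType.Exports.

Local Open Scope classical_set_scope.
Local Open Scope ring_scope.

Definition Gr (R : realType) (k n : nat) :=
  {V : {vspace 'rV[R]_n} | \dim V == k}.

Definition represents (R : realType) (k n : nat)
    (C : 'M[R]_(k, n)) (V : Gr R k n) : Prop :=
  <<[seq row i C | i : 'I_k]>>%VS = val V.

Definition nonneg_maximal_minors (R : realType) (k n : nat)
    (C : 'M[R]_(k, n)) : Prop :=
  forall f : 'I_k -> 'I_n, {homo f : i j / (i < j)%N} ->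
    0 <= \det (colsub f C).

Definition Gr_nonneg (R : realType) (k n : nat) : set (Gr R k n) :=
  [set V | exists2 C : 'M[R]_(k, n), represents C V & nonneg_maximal_minors C].

Definition Mat_pos (R : realType) (n m : nat) : set 'M[R]_(n, m) :=
  [set Z | forall f : 'I_m -> 'I_n, {homo f : i j / (i < j)%N} ->
    0 < \det (rowsub f Z)].

Definition amplituhedron (R : realType) (k n : nat)
    (Z : 'M[R]_(n, k + 2)) : set (Gr R k (k + 2)) :=
  [set V | exists W : Gr R k n, Gr_nonneg W /\
    exists2 C : 'M[R]_(k, n), represents C W & represents (C *m Z) V].

Definition twistor (R : realType) (k n : nat) (Z : 'M[R]_(n, k + 2))
    (Y : 'M[R]_(k, k + 2)) (i j : 'I_n) : R :=
  \det (col_mx Y (col_mx (row i Z) (row j Z)) : 'M[R]_(k + 2)).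

(* Indices are 0-based and [ordS] is the cyclic successor of ['I_n], so the
   pairs (i, ordS i) are (1,2), ..., (n-1,n), (n,1) in 1-based notation. *)
Definition Gr_wcb (R : realType) (k n : nat) (Z : 'M[R]_(n, k + 2)) :
    set (Gr R k (k + 2)) :=
  [set V | exists2 Y : 'M[R]_(k, k + 2), represents Y V &
    forall i : 'I_n, twistor Z Y i (ordS i) != 0].

Definition coarse_boundary_conditions (R : realType) (k n : nat)
    (Z : 'M[R]_(n, k + 2)) (Y : 'M[R]_(k, k + 2)) : Prop :=
  (forall i : 'I_n, (i.+1 < n)%N -> 0 <= twistor Z Y i (ordS i)) /\
  (forall i : 'I_n, i.+1 = n -> 0 <= (-1) ^+ (k + 1) * twistor Z Y i (ordS i)).

Definition normalize (R : realType) (x : 'rV[R]_2) : 'rV[R]_2 :=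
  (Num.sqrt (x 0 0 ^+ 2 + x 0 1 ^+ 2))^-1 *: x.

Definition circle_point (R : realType) (a : R) : 'rV[R]_2 :=
  \row_(j < 2) (if j == 0 then cos a else sin a).

(* The degree of a closed path u : [a, b] -> S^1 is the total variation, in
   turns, of a continuous determination of its angle. *)
Definition is_degree (R : realType) (a b : R) (u : R -> 'rV[R]_2) (d : int) :
    Prop :=
  exists theta : R -> R,
    [/\ {within `[a, b], continuous theta},
        forall t, a <= t <= b -> u t = circle_point (theta t)
      & theta b - theta a = 2 * pi * d%:~R].

(* gamma runs through [z_i, z_(i+1)] for time in [i, i+1]. *)
Definition is_closed_polygon (R : realType) (n : nat)
    (z : 'I_n -> 'rV[R]_2) (gamma : R -> 'rV[R]_2) : Prop :=
  forall (i : 'I_n) (t : R), 0 <= t <= 1 ->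
    gamma (i%:R + t) = (1 - t) *: z i + t *: z (ordS i).

(* If col_mx Y f is invertible, the classes of the two rows of f form a basis
   of the quotient of R^(k+2) by the row space of Y, and this is the
   coordinate vector of the class of v in that basis. *)
Definition quotient_coord (R : realType) (k : nat) (Y : 'M[R]_(k, k + 2))
    (f : 'M[R]_(2, k + 2)) (v : 'rV[R]_(k + 2)) : 'rV[R]_2 :=
  rsubmx (v *m invmx (col_mx Y f)).

Definition is_winding_number (R : realType) (k n : nat)
    (Z : 'M[R]_(n, k + 2)) (Y : 'M[R]_(k, k + 2)) (w : int) : Prop :=
  exists f : 'M[R]_(2, k + 2), 0 < \det (col_mx Y f) /\
    exists2 gamma : R -> 'rV[R]_2,
      is_closed_polygon (fun i : 'I_n => quotient_coord Y f (row i Z)) gamma &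
      is_degree 0 n%:R (fun t => normalize (gamma t)) w.

(* Depends on the representative Y only through the orientation it puts on the
   quotient.  Junk value 0 when Y is not of full rank or when the polygon meets
   the origin. *)
Definition winding_number (R : realType) (k n : nat)
    (Z : 'M[R]_(n, k + 2)) (Y : 'M[R]_(k, k + 2)) : int :=
  xget 0 [set w | is_winding_number Z Y w].

(* Main.v *)
Require Import Defs.
From HB Require Import structures.
From mathcomp Require Import all_boot all_order all_algebra.
From mathcomp Require Import all_classical all_reals all_analysis.
From mathcomp Require Import zify ring lra.

Set Implicit Arguments.
Unset Strict Implicit.
Unset Printing Implicit Defensive.

Import Order.TTheory GRing.Theory Num.Theory.
Import numFieldNormedType.Exports.

Local Open Scope classical_set_scope.
Local Open Scope ring_scope.

(* Write z_i for the image of the i-th row of Z in the plane R^(k+2)/Y and phi_i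
   for the angle of z_i continued along the polygon from phi_1 = 0; every edge
   turns by less than pi.  The sequence det(z_1, z_i), of the sign of sin phi_i,
   lies in the column span of Z, hence cannot have k+3 weakly alternating
   entries unless these vanish (Gantmakher-Krein).
   If w > floor((k+1)/2), then phi_n > (k+1) pi; the index 1, the index before
   the first passage of pi and the first passages of pi, ..., (k+1) pi are k+3
   such entries.
   If w = floor((k+1)/2), the coarse boundary conditions give phi_n > k pi.  Let
   s_m be the first passage of m pi and p_m = s_m - 1.  The linear relation
   between z_1, z_(p_m), z_(s_m), suitably signed, is a vector with three nonzero
   entries sent into Y by Z; the k x n matrix C of these vectors has nonnegative
   maximal minors and C Z has rank k. *)

(** * Determinants of products and sign alternation in column spans *)

(** Multilinearity in the rows of the product: this is the Cauchy-Binet expansion before the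
    selections [h] are grouped by their image. *)
Lemma det_mulmx_sum (R : comPzRingType) (m n : nat) (D : 'M[R]_(m, n))
    (Z : 'M[R]_(n, m)) :
  \det (D *m Z) =
  \sum_(h : {ffun 'I_m -> 'I_n}) (\prod_r D r (h r)) * \det (rowsub h Z).
Proof.
rewrite /determinant.
under [RHS]eq_bigr => h _ do rewrite mulr_sumr.
rewrite exchange_big /=; apply: eq_bigr => s _.
under eq_bigr => i _ do rewrite mxE.
rewrite bigA_distr_bigA mulr_sumr /=; apply: eq_bigr => h _.
rewrite big_split /= mulrCA; congr (_ * (_ * _)).
by apply: eq_bigr => i _; rewrite mxE.
Qed.

(** The inequality is weak because two rows may share a column, as two triangles of the fan below
    may share a vertex. *)
Definition staircase (R : nzRingType) (m n : nat) (D : 'M[R]_(m, n)) : Prop :=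
  forall (r r' : 'I_m) (c c' : 'I_n), (r < r')%N ->
    D r c != 0 -> D r' c' != 0 -> (c <= c')%N.

(* A nonzero product forces h to be weakly increasing: the minor of Z is then
   either 0, by a repeated row, or has its rows in increasing order. *)
Lemma staircase_term (R : realDomainType) (m n : nat) (D : 'M[R]_(m, n))
    (Z : 'M[R]_(n, m)) (h : {ffun 'I_m -> 'I_n}) :
  (forall r c, 0 <= D r c) -> staircase D ->
  (forall f : 'I_m -> 'I_n, {homo f : i j / (i < j)%N} ->
     0 <= \det (rowsub f Z)) ->
  0 <= (\prod_r D r (h r)) * \det (rowsub h Z).
Proof.
move=> D0 Ds hZ.
have [/existsP[r /eqP Dr0]|/existsPn Dn0] := boolP [exists r, D r (h r) == 0].
  by rewrite (bigD1 r)//= Dr0 !mul0r.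
have hle (r r' : 'I_m) : (r < r')%N -> (h r <= h r')%N by move=> rr'; exact: Ds rr' _ _.
have [/injectiveP hinj|/injectivePn[r [r' rr' hrr']]] := boolP (injectiveb h).
  apply: mulr_ge0; first by apply: prodr_ge0.
  apply: hZ => r r' rr'; rewrite ltn_neqAle hle// andbT.
  by apply/eqP => /val_inj/hinj err'; rewrite err' ltnn in rr'.
rewrite (determinant_alternate rr') ?mulr0// => j.
by rewrite !mxE hrr'.
Qed.

Lemma det_staircase_ge0 (R : realDomainType) (m n : nat) (D : 'M[R]_(m, n))
    (Z : 'M[R]_(n, m)) :
  (forall r c, 0 <= D r c) -> staircase D ->
  (forall f : 'I_m -> 'I_n, {homo f : i j / (i < j)%N} ->
     0 <= \det (rowsub f Z)) ->
  0 <= \det (D *m Z).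
Proof.
move=> D0 Ds hZ; rewrite det_mulmx_sum.
by apply: sumr_ge0 => h _; exact: staircase_term.
Qed.

(** The selection [f] contributes a positive term to the expansion, and all other terms are
    nonnegative. *)
Lemma det_staircase_gt0 (R : realType) (m n : nat) (D : 'M[R]_(m, n))
    (Z : 'M[R]_(n, m)) (f : 'I_m -> 'I_n) :
  (forall r c, 0 <= D r c) -> staircase D -> Mat_pos Z ->
  {homo f : i j / (i < j)%N} -> (forall r, 0 < D r (f r)) ->
  0 < \det (D *m Z).
Proof.
move=> D0 Ds hZ fm fD; rewrite det_mulmx_sum.
rewrite (bigD1 (finfun f))//= ltr_wpDr//.
  by apply: sumr_ge0 => h _; apply: staircase_term => // g /hZ/ltW.
apply: mulr_gt0; first by apply: prodr_gt0 => r _; rewrite ffunE.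
by apply: hZ => i j ij; rewrite !ffunE fm.
Qed.

Lemma homo_ltn_ord_id (m : nat) (f : 'I_m -> 'I_m) :
  {homo f : i j / (i < j)%N} -> f =1 id.
Proof.
move=> fm.
have fge : forall (d : nat) (i : 'I_m), i = d :> nat -> (i <= f i)%N.
  elim=> [|d IH] i ei; first by rewrite ei.
  have dm : (d < m)%N by have := ltn_ord i; lia.
  have lt1 : (f (Ordinal dm) < f i)%N by apply: fm; rewrite /= ei.
  have := IH (Ordinal dm) erefl; rewrite /=; lia.
have fle : forall (d : nat) (i : 'I_m), (m - i)%N = d -> (f i <= i)%N.
  elim=> [|d IH] i ei; first by have := ltn_ord i; lia.
  have [im|mi] := ltnP i.+1 m.
    have lt1 : (f i < f (Ordinal im))%N by apply: fm.
    have := IH (Ordinal im); rewrite /=; lia.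
  by have := ltn_ord (f i); lia.
move=> i; apply/val_inj => /=; apply/eqP.
by rewrite eqn_leq (fge _ _ erefl) (fle _ _ erefl).
Qed.

(** The case [Z = 1%:M] of the product bound: the identity is the only increasing selection of all
    the rows. *)
Lemma det_staircase_sq_ge0 (R : realDomainType) (m : nat) (D : 'M[R]_m) :
  (forall r c, 0 <= D r c) -> staircase D -> 0 <= \det D.
Proof.
move=> D0 Ds; rewrite -[D]mulmx1; apply: det_staircase_ge0 => // f /homo_ltn_ord_id fid.
have -> : rowsub f 1%:M = 1%:M :> 'M[R]_m by apply/matrixP => i j; rewrite !mxE fid.
by rewrite det1.
Qed.

(* The alternating maximal minors of the m+1 chosen rows annihilate the column
   span of Z, so they pair to 0 with Z x although all terms have the same sign. *)
Lemma alternating_col_span_eq0 (R : realType) (m n : nat) (Z : 'M[R]_(n, m))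
    (x : 'cV[R]_m) (g : 'I_m.+1 -> 'I_n) :
  Mat_pos Z -> {homo g : i j / (i < j)%N} ->
  (forall j : 'I_m.+1, 0 <= (-1) ^+ j * (Z *m x) (g j) 0) ->
  forall j : 'I_m.+1, (Z *m x) (g j) 0 = 0.
Proof.
move=> hZ gm alt.
pose u := Z *m x.
(* Bordering the chosen rows of [Z] by those of [u] gives a square matrix with kernel vector [v];
   expanding its zero determinant along the column of [u] yields the relation with the minors
   [M j]. *)
pose A : 'M[R]_m.+1 := row_mx (rowsub g u) (rowsub g Z).
pose v : 'cV[R]_m.+1 := col_mx (1%:M : 'M[R]_1) (- x).
have Av : A *m v = 0.
  rewrite [LHS](@mul_row_col _ _ 1 m) mulmx1 mulmxN.
  apply/matrixP => i j; rewrite !mxE -sumrB big1// => k _.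
  by rewrite !mxE subrr.
have detA : \det A = 0.
  apply/eqP/negPn/negP => dA.
  have Au : A \in unitmx by rewrite unitmxE unitfE.
  have : v = 0 by rewrite -(mulKmx Au v) Av mulmx0.
  move=> /(congr1 (@usubmx _ 1 m 1)); rewrite col_mxKu linear0 => /matrixP/(_ 0 0).
  by rewrite !mxE eqxx => /eqP; rewrite oner_eq0.
pose M j := \det (rowsub (g \o lift j) Z).
have Mgt j : 0 < M j.
  by apply: hZ => a b ab; apply: gm; rewrite /= /bump; lia.
have termE (j : 'I_m.+1) :
    A j 0 * cofactor A j 0 = ((-1) ^+ j * u (g j) 0) * M j.
  have -> : A j 0 = u (g j) 0.
    have := row_mxEl (rowsub g u) (rowsub g Z) j 0; rewrite [RHS]mxE => <-.
    by congr (_ j _); apply/val_inj.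
  rewrite /cofactor addn0 mulrCA -mulrA; congr (_ * (_ * \det _)).
  apply/matrixP => a b; rewrite [LHS]mxE [LHS]mxE.
  transitivity (A (lift j a) (rshift 1 b)); first by congr (A _ _); apply/val_inj.
  by rewrite [LHS](row_mxEr (rowsub g u) (rowsub g Z)) !mxE.
move=> j.
have : \sum_(j : 'I_m.+1) ((-1) ^+ j * u (g j) 0) * M j = 0.
  transitivity (\det A) => //; rewrite (expand_det_col A 0).
  by apply: eq_bigr => i _; rewrite termE.
move/eqP; rewrite psumr_eq0; last by move=> i _; rewrite mulr_ge0// ltW.
move=> /allP/(_ j (mem_index_enum _)) /=.
by rewrite mulf_eq0 (gt_eqF (Mgt j)) orbF mulf_eq0 signr_eq0 => /eqP.
Qed.

(** * Row spans and representatives of points of the Grassmannian *)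

Lemma dim_span_rows (R : realType) (k m : nat) (A : 'M[R]_(k, m)) :
  (forall t : 'rV_k, t *m A = 0 -> t = 0) ->
  \dim <<[seq row i A | i : 'I_k]>> == k.
Proof.
move=> Afree.
have -> : [seq row i A | i : 'I_k] = [tuple row i A | i < k] by [].
rewrite [eqbRHS](_ : k = size [tuple row i A | i < k]); last by rewrite size_tuple.
apply/freeP => t.
under eq_bigr => i _ do rewrite -tnth_nth tnth_mktuple.
move=> t0 i; have /Afree/rowP/(_ i) : (\row_j t j) *m A = 0.
  by rewrite mulmx_sum_row -[RHS]t0; apply: eq_bigr => j _; rewrite mxE.
by rewrite !mxE.
Qed.

Lemma represents_mem (R : realType) (k m : nat) (Y : 'M[R]_(k, m)) (V : Gr R k m)
    (l : 'rV_k) :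
  represents Y V -> l *m Y \in val V.
Proof.
move=> <-; rewrite mulmx_sum_row; apply: memv_suml => i _; apply: memvZ.
by apply: memv_span; apply/fintype.imageP; exists i.
Qed.

Lemma mem_represents (R : realType) (k m : nat) (Y : 'M[R]_(k, m)) (V : Gr R k m)
    (v : 'rV_m) :
  represents Y V -> v \in val V -> exists l : 'rV_k, v = l *m Y.
Proof.
move=> <-.
have -> : [seq row i Y | i : 'I_k] = [tuple row i Y | i < k] by [].
move/coord_span => vE; exists (\row_i coord [tuple row i Y | i < k] i v).
rewrite {1}vE mulmx_sum_row; apply: eq_bigr => i _.
by rewrite mxE -tnth_nth tnth_mktuple.
Qed.

Lemma represents_free (R : realType) (k m : nat) (A : 'M[R]_(k, m)) (V : Gr R k m) :
  (forall t : 'rV_k, t *m A = 0 -> t = 0) ->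
  (forall i, row i A \in val V) -> represents A V.
Proof.
move=> /dim_span_rows/eqP dimA AV; apply/eqP; rewrite eqEdim dimA.
rewrite (eqP (valP V)) leqnn andbT; apply/span_subvP => v /fintype.imageP[i _ ->].
exact: AV.
Qed.

(** * Fan matrices: nonnegative minors, rank, and membership in the amplituhedron *)

(** Column [0] is reserved for the apex common to all triangles, while successive segments from
    [p r] to [s r] may share an endpoint. *)
Definition interlacing (k : nat) (p s : nat -> nat) : Prop :=
  (forall r, (r < k)%N -> (0 < p r < s r)%N) /\
  (forall r r', (r < r')%N -> (r' < k)%N -> (s r <= p r')%N).

Definition fan_entry (R : realType) (p s : nat -> nat) (b c : nat -> R)
    (r j : nat) : R :=
  b r * (j == p r)%:R + c r * (j == s r)%:R.

(** Row [r] is supported on the triangle with vertices [0], [p r], [s r]. The sign of its apex entry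
    anticipates the cofactor sign in an expansion along column [0]. *)
Definition fan_matrix (R : realType) (k n : nat) (p s : nat -> nat)
    (a b c : nat -> R) : 'M[R]_(k, n) :=
  \matrix_(r, j) ((-1) ^+ r * a r * (j == 0 :> nat)%:R + fan_entry p s b c r j).

Lemma fan_entry_ge0 (R : realType) (p s : nat -> nat) (b c : nat -> R) (r j : nat) :
  0 <= b r -> 0 < c r -> 0 <= fan_entry p s b c r j.
Proof. by move=> b0 c0; rewrite addr_ge0// mulr_ge0// ltW. Qed.

Lemma fan_entry_neq0 (R : realType) (p s : nat -> nat) (b c : nat -> R) (r j : nat) :
  fan_entry p s b c r j != 0 -> j = p r \/ j = s r.
Proof.
rewrite /fan_entry; case: (eqVneq j (p r)) => [->|_]; first by left.
case: (eqVneq j (s r)) => [->|_]; first by right.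
by rewrite !mulr0 addr0 eqxx.
Qed.

Lemma fan_entry_le (R : realType) (k : nat) (p s : nat -> nat) (b c : nat -> R)
    (r r' j j' : nat) :
  interlacing k p s -> (r < r')%N -> (r' < k)%N ->
  fan_entry p s b c r j != 0 -> fan_entry p s b c r' j' != 0 -> (j <= j')%N.
Proof.
move=> [ps sp] rr' r'k /fan_entry_neq0 hj /fan_entry_neq0 hj'.
have := ps r (ltn_trans rr' r'k); have := ps r' r'k; have := sp r r' rr' r'k.
lia.
Qed.

(** Increasing selections of rows and columns preserve the staircase shape. *)
Lemma fan_entry_det_ge0 (R : realType) (k m n : nat) (p s : nat -> nat)
    (b c : nat -> R) (g : 'I_m -> 'I_k) (f : 'I_m -> 'I_n) :
  interlacing k p s ->
  (forall r, (r < k)%N -> 0 <= b r) -> (forall r, (r < k)%N -> 0 < c r) ->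
  {homo g : i j / (i < j)%N} -> {homo f : i j / (i < j)%N} ->
  0 <= \det (\matrix_(i, j) fan_entry p s b c (g i) (f j)).
Proof.
move=> hps b0 c0 gm fm; apply: det_staircase_sq_ge0 => [i j|i i' j j' ii'].
  by rewrite mxE; apply: fan_entry_ge0; [exact: b0|exact: c0].
rewrite !mxE => h h'.
have := fan_entry_le hps (gm _ _ ii') (ltn_ord _) h h'.
by rewrite leqNgt => fj; rewrite leqNgt; apply: contra fj => /fm.
Qed.

(** A minor avoiding column [0] is a staircase determinant. Otherwise column [0] comes first;
    expanding along it, the sign of each apex entry cancels the cofactor sign and staircase
    determinants remain. *)
Lemma fan_matrix_nonneg (R : realType) (k n : nat) (p s : nat -> nat)
    (a b c : nat -> R) :
  interlacing k p s -> (forall r, (r < k)%N -> 0 <= a r) ->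
  (forall r, (r < k)%N -> 0 <= b r) -> (forall r, (r < k)%N -> 0 < c r) ->
  nonneg_maximal_minors (fan_matrix k n p s a b c).
Proof.
move=> hps a0 b0 c0 f fm.
case: k f hps a0 b0 c0 fm => [|k] f hps a0 b0 c0 fm; first by rewrite det_mx00.
have fpos (j : 'I_k.+1) : (0 < j)%N -> (0 < f j)%N.
  by move=> j0; have := fm ord0 j j0; lia.
have [f0|f0] := eqVneq (f ord0 : nat) 0%N; last first.
  rewrite (_ : colsub f _ = \matrix_(i, j) fan_entry p s b c i (f j)).
    exact: (fan_entry_det_ge0 (g := id)).
  apply/matrixP => i j; rewrite !mxE.
  rewrite (_ : (f j == 0 :> nat) = false) ?mulr0 ?add0r//; apply/negbTE.
  by have [->//|j0] := eqVneq j ord0; rewrite -lt0n fpos// lt0n.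
rewrite (expand_det_col _ ord0); apply: sumr_ge0 => r _.
rewrite !mxE f0 eqxx mulr1 /cofactor addn0.
have -> : fan_entry p s b c r 0 = 0.
  have := hps.1 r (ltn_ord r); rewrite /fan_entry.
  by move=> /andP[p0 ps]; rewrite !ltn_eqF ?mulr0 ?addr0//; exact: ltn_trans p0 ps.
rewrite addr0 mulrCA !mulrA -expr2 sqrr_sign mul1r; apply: mulr_ge0; first exact: a0.
rewrite (_ : row' _ _ =
    \matrix_(i, j) fan_entry p s b c (lift r i) ((f \o lift ord0) j)).
  apply: (fan_entry_det_ge0 (f := f \o lift ord0)) hps b0 c0 _ _.
    by move=> i j; rewrite /= !ltnNge leq_bump2.
  by move=> i j ij; apply: fm; rewrite /= ltnNge leq_bump2 -ltnNge.
apply/matrixP => i j; rewrite !mxE.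
rewrite (_ : (f (lift ord0 j) == 0 :> nat) = false) ?mulr0 ?add0r//; apply/negbTE.
by rewrite -lt0n fpos.
Qed.

(* Completing the rows of the matrix with the first two unit vectors, the first
   of which clears the signed column 0, gives a nonnegative staircase matrix. *)
Lemma fan_matrix_mulmx_free (R : realType) (k m n : nat) (p s : nat -> nat)
    (a b c : nat -> R) (Z : 'M[R]_(n, m)) (t : 'rV[R]_k) :
  m = k.+2 -> (m <= n)%N -> Mat_pos Z -> interlacing k p s ->
  (forall r, (r < k)%N -> (s r < n)%N) ->
  (forall r, (r < k)%N -> 0 <= b r) -> (forall r, (r < k)%N -> 0 < c r) ->
  t *m (fan_matrix k n p s a b c *m Z) = 0 -> t = 0.
Proof.
move=> mk; subst m => kn hZ hps sn b0 c0 tCZ.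
pose dn (r j : nat) : R := if r is r'.+2 then fan_entry p s b c r' j else (j == r)%:R.
pose D : 'M[R]_(k.+2, n) := \matrix_(r, j) dn r j.
(* The selection [0], [1], [s 0], [s 1], ... is strictly increasing because [0 < p r < s r] forces
   [s r >= 2]. *)
pose hn (r : nat) := if r is r'.+2 then s r' else r.
have hnn (r : 'I_k.+2) : (hn r < n)%N.
  case: r => [[|[|r]]] rk //=; [lia|lia|exact: sn].
have dD : 0 < \det (D *m Z).
  apply: (det_staircase_gt0 (f := fun r => Ordinal (hnn r))) => //.
  - move=> r j; rewrite mxE; case: r => [[|[|r]]] rk //=.
    by apply: fan_entry_ge0; [exact: b0|exact: c0].
  - move=> r r' j j' rr'; rewrite !mxE.
    case: r rr' => [[|[|r]]] rk; case: r' => [[|[|r']]] r'k //= rr'.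
    + by rewrite pnatr_eq0 eqb0 negbK => /eqP ->.
    + by rewrite pnatr_eq0 eqb0 negbK => /eqP ->.
    + rewrite pnatr_eq0 eqb0 negbK => /eqP ->.
      by move=> /fan_entry_neq0; have := hps.1 r' r'k; lia.
    + exact: fan_entry_le hps _ _.
  - move=> r r' rr' /=.
    case: r rr' => [[|[|r]]] rk; case: r' => [[|[|r']]] r'k //= rr'.
    + by have := hps.1 r' (r'k : (r' < k)%N); lia.
    + by have := hps.1 r' (r'k : (r' < k)%N); lia.
    + have := hps.1 r' r'k; have := hps.2 r r' rr' r'k; rewrite /=; lia.
  - move=> r; rewrite mxE /=; case: r => [[|[|r]]] rk //=; rewrite ?eqxx //.
    rewrite /fan_entry eqxx mulr1 ltr_wpDl//; last exact: c0.
    by rewrite mulr_ge0// b0.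
(* The coefficient of the first unit vector collects the signed apex entries, so that [y *m D]
   recovers the combination [t] of the rows of the fan matrix. *)
pose u : 'rV[R]_2 := \row_j if j == 0 then \sum_(i < k) t 0 i * ((-1) ^+ i * a i) else 0.
pose y : 'rV[R]_k.+2 := row_mx u t.
have yD : y *m D = t *m fan_matrix k n p s a b c.
  apply/rowP => j; rewrite mxE big_ord_recl big_ord_recl /= [RHS]mxE.
  have -> : y 0 ord0 = \sum_(i < k) t 0 i * ((-1) ^+ i * a i).
    have := row_mxEl u t 0 0; rewrite [RHS]mxE eqxx => <-.
    by congr (y _ _); apply/val_inj.
  have -> : y 0 (lift ord0 ord0) = 0.
    have := row_mxEl u t 0 1; rewrite [RHS]mxE /= => <-.
    by congr (y _ _); apply/val_inj.
  rewrite mul0r add0r mxE mulr_suml -big_split /=; apply: eq_bigr => i _.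
  have -> : y 0 (lift ord0 (lift ord0 i)) = t 0 i.
    by rewrite -(row_mxEr u t 0 i); congr (y _ _); apply/val_inj.
  by rewrite !mxE /= -mulrA -mulrDr.
have y0 : y = 0.
  have Du : D *m Z \in unitmx by rewrite unitmxE unitfE gt_eqF.
  have yDZ : y *m (D *m Z) = 0 by rewrite mulmxA yD -mulmxA.
  by rewrite -(mulmxK Du y) yDZ mul0mx.
by move: y0 => /(congr1 (@rsubmx _ 1 2 k)); rewrite row_mxKr linear0.
Qed.

(** Independence of the rows of [C *m Z], for [C] the fan matrix, serves twice: it makes the rows of
    [C] independent, so that they span a point of [Gr_nonneg], and by dimension it turns the
    inclusion of the rows in [V] into an equality of spans. *)
Lemma fan_amplituhedron (R : realType) (k n : nat) (p s : nat -> nat)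
    (a b c : nat -> R) (Z : 'M[R]_(n, k + 2)) (V : Gr R k (k + 2)) :
  (k + 2 <= n)%N -> Mat_pos Z -> interlacing k p s ->
  (forall r, (r < k)%N -> (s r < n)%N) ->
  (forall r, (r < k)%N -> 0 <= a r) ->
  (forall r, (r < k)%N -> 0 <= b r) -> (forall r, (r < k)%N -> 0 < c r) ->
  (forall r, row r (fan_matrix k n p s a b c *m Z) \in val V) ->
  amplituhedron Z V.
Proof.
move=> kn hZ hps sn a0 b0 c0 CV.
have CZfree (t : 'rV_k) : t *m (fan_matrix k n p s a b c *m Z) = 0 -> t = 0.
  by apply: fan_matrix_mulmx_free; rewrite ?addn2 // -addn2.
have Cfree (t : 'rV_k) : t *m fan_matrix k n p s a b c = 0 -> t = 0.
  by move=> tC; apply: CZfree; rewrite mulmxA tC mul0mx.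
exists (exist _ <<[seq row i (fan_matrix k n p s a b c) | i : 'I_k]>>%VS
  (dim_span_rows Cfree)); split; exists (fan_matrix k n p s a b c) => //.
  exact: fan_matrix_nonneg.
exact: represents_free.
Qed.

Lemma row_fan_matrix_mulmx (R : realType) (k n m : nat) (p s : nat -> nat)
    (a b c : nat -> R) (Z : 'M[R]_(n, m)) (r : 'I_k) (i0 ip is_ : 'I_n) :
  i0 = 0 :> nat -> ip = p r :> nat -> is_ = s r :> nat ->
  row r (fan_matrix k n p s a b c *m Z) =
  ((-1) ^+ r * a r) *: row i0 Z + b r *: row ip Z + c r *: row is_ Z.
Proof.
move=> e0 ep es; apply/rowP => j; rewrite !mxE.
have pick (i : 'I_n) (x : R) :
    \sum_(l < n) x * (l == i :> nat)%:R * Z l j = x * Z i j.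
  rewrite (bigD1 i)//= eqxx mulr1 big1 ?addr0// => l li.
  by rewrite (negbTE (_ : l != i :> nat)) ?mulr0 ?mul0r.
rewrite -!pick -!big_split /=; apply: eq_bigr => l _.
by rewrite !mxE e0 ep es /fan_entry !mulrDl addrA.
Qed.

(** * Angles of plane vectors and of closed polygons *)

Definition cross (R : realType) (u v : 'rV[R]_2) : R :=
  u 0 0 * v 0 1 - u 0 1 * v 0 0.

Lemma cross_circle_point (R : realType) (r s x y : R) :
  cross (r *: circle_point x) (s *: circle_point y) = r * s * sin (y - x).
Proof. by rewrite /cross !mxE /= sinB; ring. Qed.

Lemma normalize_circle_point (R : realType) (v : 'rV[R]_2) (x : R) :
  normalize v = circle_point x -> exists2 r, 0 < r & v = r *: circle_point x.
Proof.
rewrite /normalize; set r := Num.sqrt _ => vx.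
have r0 : r != 0.
  apply/eqP => r0; move: vx; rewrite r0 invr0 scale0r => /rowP vx.
  have := cos2Dsin2 x; have := vx 0; have := vx 1; rewrite !mxE /= => <- <-.
  by rewrite expr0n /= addr0 => /eqP; rewrite eq_sym oner_eq0.
exists r; first by rewrite lt_def r0 sqrtr_ge0.
by rewrite -vx scalerA divff// scale1r.
Qed.

Lemma sin_shift_pi (R : realType) (m : nat) (x : R) :
  sin x = (-1) ^+ m * sin (x - m%:R * pi).
Proof.
by rewrite -(alternatingn (@sinDpi R)) -[X in _ + X]mulr_natl subrK.
Qed.

Lemma sin_sign_gt0 (R : realType) (m : nat) (x : R) :
  m%:R * pi < x < m.+1%:R * pi -> 0 < (-1) ^+ m * sin x.
Proof.
move=> /andP[mx xm]; rewrite (sin_shift_pi m) mulrA -expr2 sqrr_sign mul1r.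
by apply: sin_gt0_pi; rewrite -natr1 mulrDl mul1r in xm; apply/andP; split; lra.
Qed.

Lemma sin_sign_ge0 (R : realType) (m : nat) (x : R) :
  m%:R * pi <= x < m.+1%:R * pi -> 0 <= (-1) ^+ m * sin x.
Proof.
move=> /andP[mx xm]; rewrite (sin_shift_pi m) mulrA -expr2 sqrr_sign mul1r.
by apply: sin_ge0_pi; rewrite -natr1 mulrDl mul1r in xm; apply/andP; split; lra.
Qed.

(** By the intermediate value theorem, a variation of at least [pi] would make [theta] reach
    [theta a + pi] or [theta a - pi] after time [a], where the sine vanishes. *)
Lemma sin_neq0_lt_pi (R : realType) (a b : R) (theta : R -> R) : a <= b ->
  {within `[a, b], continuous theta} ->
  (forall t, a < t <= b -> sin (theta t - theta a) != 0) ->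
  `|theta b - theta a| < pi.
Proof.
move=> ab ct sn0; rewrite ltNge; apply/negP => hpi.
have ineq : exists2 e : R, sin e = 0 & e != 0 /\
    Num.min (theta a) (theta b) <= theta a + e <= Num.max (theta a) (theta b).
  have pi0 := pi_gt0 R.
  have [h|h] := lerP 0 (theta b - theta a).
    exists pi; first exact: sinpi.
    split; first by rewrite gt_eqF.
    rewrite ger0_norm// in hpi; rewrite ge_min le_max; apply/andP; split.
      by apply/orP; left; lra.
    by apply/orP; right; lra.
  exists (- pi); first by rewrite sinN sinpi oppr0.
  split; first by rewrite oppr_eq0 gt_eqF.
  rewrite ltr0_norm// in hpi; rewrite ge_min le_max; apply/andP; split.
    by apply/orP; right; lra.
  by apply/orP; left; lra.
case: ineq => e se [e0 /(IVT ab ct)[t]]; rewrite in_itv /= => /andP[at_ tb] te.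
have := sn0 t; rewrite te addrC addKr se eqxx tb andbT.
suff : a < t by move=> -> /(_ isT).
rewrite lt_neqAle at_ andbT; apply: contra e0 => /eqP ea.
by rewrite -(addKr (theta a) e) -te -ea addNr.
Qed.

(** [phi] samples the continuous angle at the vertices, and [phi n.+1] records the return to the
    first vertex. An edge turns by less than [pi] because the cross product of [z i] with the point
    at fraction [x] of the edge is [x] times the nonzero [cross (z i) (z (ordS i))]. *)
Lemma polygon_angles (R : realType) (n : nat) (z : 'I_n.+1 -> 'rV[R]_2)
    (gamma : R -> 'rV[R]_2) (w : int) :
  is_closed_polygon z gamma ->
  is_degree 0 n.+1%:R (fun t => normalize (gamma t)) w ->
  (forall i, cross (z i) (z (ordS i)) != 0) ->
  exists phi : nat -> R,
    [/\ phi 0%N = 0, phi n.+1 = 2 * pi * w%:~R,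
      forall i : 'I_n.+1, `|phi i.+1 - phi i| < pi,
      forall i : 'I_n.+1, exists2 r, 0 < r &
        cross (z i) (z (ordS i)) = r * sin (phi i.+1 - phi i)
    & forall i : 'I_n.+1, exists2 r, 0 < r & cross (z ord0) (z i) = r * sin (phi i)].
Proof.
move=> hg [theta [ct hu hw]] zn0.
have gE (t : R) : 0 <= t <= n.+1%:R ->
    exists2 r, 0 < r & gamma t = r *: circle_point (theta t).
  by move=> /hu; exact: normalize_circle_point.
have itv (i : 'I_n.+1) (t : R) : 0 <= t <= 1 -> 0 <= i%:R + t <= n.+1%:R.
  move=> /andP[t0 t1]; rewrite addr_ge0//=.
  have : (i.+1%:R : R) <= n.+1%:R by rewrite ler_nat.
  by rewrite -natr1; apply: le_trans; rewrite lerD2l.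
have g0 (i : 'I_n.+1) : gamma i%:R = z i.
  by rewrite -[i%:R]addr0 hg ?lexx ?ler01// subr0 scale1r scale0r addr0.
have g1 (i : 'I_n.+1) : gamma i.+1%:R = z (ordS i).
  by rewrite -natr1 hg ?lexx ?ler01// subrr scale0r scale1r add0r.
have itv0 (i : 'I_n.+1) : 0 <= (i%:R : R) <= n.+1%:R.
  by rewrite ler0n ler_nat ltnW.
have itv1 (i : 'I_n.+1) : 0 <= (i.+1%:R : R) <= n.+1%:R.
  by rewrite ler0n ler_nat ltn_ord.
exists (fun i => theta i%:R - theta 0); split => [||i|i|i].
- by rewrite subrr.
- exact: hw.
- rewrite opprB addrA subrK; apply: sin_neq0_lt_pi.
  + by rewrite ler_nat.
  + apply: continuous_subspaceW ct; move=> x /=; rewrite !in_itv/=.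
    have /andP[i0 _] := itv0 i; have /andP[_ i1] := itv1 i.
    by move=> /andP[/(le_trans i0) -> /le_trans]; apply.
  + move=> t /andP[it ti].
    pose x := t - i%:R.
    have x01 : 0 <= x <= 1 by rewrite /x -natr1 in ti *; apply/andP; split; lra.
    have tE : t = i%:R + x by rewrite /x addrC subrK.
    have := zn0 i; apply: contra => /eqP s0.
    have [r r0 er] := gE _ (itv0 i); have [r' r'0 er'] := gE _ (itv i x x01).
    have : cross (gamma i%:R) (gamma (i%:R + x)) = 0.
      by rewrite er er' cross_circle_point -tE s0 mulr0.
    rewrite g0 hg// => c0.
    have : x * cross (z i) (z (ordS i)) = 0.
      by rewrite -c0 /cross !mxE; ring.
    move/eqP; rewrite mulf_eq0 => /orP[|//].
    by rewrite /x subr_eq0 gt_eqF.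
- have [r r0 er] := gE _ (itv0 i); have [r' r'0 er'] := gE _ (itv1 i).
  exists (r * r'); first exact: mulr_gt0.
  by rewrite -g0 -g1 er er' cross_circle_point; congr (_ * sin _); ring.
- have [r r0 er] := gE _ (itv0 ord0); have [r' r'0 er'] := gE _ (itv0 i).
  exists (r * r'); first exact: mulr_gt0.
  by rewrite -!g0 er er' cross_circle_point.
Qed.

(** * First passages of a real sequence with bounded increments *)

(** Take for [j m] the least index where [phi] reaches [m%:R * d]. An increment below [d] cannot
    skip a band of width [d], which locates [phi] just before and at the passage. *)
Lemma first_passage (R : realType) (phi : nat -> R) (d : R) (N K : nat) :
  0 < d -> phi 0%N = 0 ->
  (forall i, (i < N)%N -> phi i.+1 - phi i < d) -> K%:R * d <= phi N ->
  exists j : nat -> nat,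
    (forall m, (0 < m <= K)%N ->
       [/\ (0 < j m <= N)%N, m%:R * d <= phi (j m) < m.+1%:R * d &
           m.-1%:R * d < phi (j m).-1 < m%:R * d]) /\
    (forall m m', (0 < m < m')%N -> (m' <= K)%N -> (j m <= (j m').-1)%N).
Proof.
move=> d0 phi0 step KN.
(* The alternative [i == N] makes the search total; for [m <= K] the index [N] reaches the threshold
   anyway. *)
have ex m : exists i, (i == N) || (m%:R * d <= phi i) by exists N; rewrite eqxx.
pose j m := ex_minn (ex m).
have jP m : (0 < m <= K)%N -> [/\ (0 < j m <= N)%N, m%:R * d <= phi (j m) < m.+1%:R * d,
    m.-1%:R * d < phi (j m).-1 < m%:R * d &
    forall i, m%:R * d <= phi i -> (j m <= i)%N].
  move=> /andP[m0 mK]; rewrite /j; case: ex_minnP => i hi imin.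
  have iN : (i <= N)%N by apply: imin; rewrite eqxx.
  have phii : m%:R * d <= phi i.
    case/orP: hi => // /eqP ->; apply: le_trans KN.
    by rewrite ler_pM2r// ler_nat.
  have i0 : (0 < i)%N.
    rewrite lt0n; apply/eqP => i0; move: phii; rewrite i0 phi0 leNgt.
    by rewrite mulr_gt0// ltr0n.
  have lti : phi i.-1 < m%:R * d.
    rewrite ltNge; apply/negP => h; have := imin i.-1; rewrite h orbT => /(_ isT).
    by rewrite leqNgt prednK// leqnn.
  have := step i.-1; rewrite prednK// => /(_ iN) st.
  have mE : m%:R = m.-1%:R + 1 :> R by rewrite natr1 prednK.
  rewrite i0 iN phii lti -natr1 mE; rewrite mE in phii lti; split => //.
  - by apply/andP; split => //; rewrite !mulrDl mul1r in phii lti *; lra.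
  - by apply/andP; split => //; rewrite !mulrDl mul1r in phii lti *; lra.
  - by move=> i' hi'; apply: imin; rewrite mE hi' orbT.
exists j; split => [m /jP[]//|m m' /andP[m0 mm'] m'K].
have mK : (0 < m <= K)%N by rewrite m0 (leq_trans (ltnW mm')).
have m'K' : (0 < m' <= K)%N by rewrite m'K andbT (leq_ltn_trans _ mm').
have [_ _ _ jmin] := jP m mK; have [_ _ /andP[h _] _] := jP m' m'K'.
(* Just before passing [m'%:R * d] the sequence exceeds [m'.-1%:R * d], hence [m%:R * d]; minimality
   of [j m] concludes. *)
apply: jmin; apply: le_trans (ltW h); rewrite ler_pM2r// ler_nat.
by rewrite -ltnS prednK// (leq_ltn_trans _ mm').
Qed.

(** * Coordinates on the quotient plane and twistors *)

Lemma quotient_coordE (R : realType) (k : nat) (Y : 'M[R]_(k, k + 2))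
    (f : 'M[R]_(2, k + 2)) (v : 'rV[R]_(k + 2)) :
  quotient_coord Y f v = v *m rsubmx (invmx (col_mx Y f)).
Proof. by rewrite mulmx_rsub. Qed.

Lemma quotient_coord_eq0 (R : realType) (k : nat) (Y : 'M[R]_(k, k + 2))
    (f : 'M[R]_(2, k + 2)) (v : 'rV[R]_(k + 2)) :
  \det (col_mx Y f) != 0 -> quotient_coord Y f v = 0 ->
  exists l : 'rV_k, v = l *m Y.
Proof.
move=> dB v0; exists (lsubmx (v *m invmx (col_mx Y f))).
have Bu : col_mx Y f \in unitmx by rewrite unitmxE unitfE.
rewrite -{1}(mulmxKV Bu v) -{1}(hsubmxK (v *m invmx _)) mul_row_col.
by rewrite [rsubmx _]v0 mul0mx addr0.
Qed.

Lemma det_mx2 (R : comNzRingType) (A : 'M[R]_2) :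
  \det A = A 0 0 * A 1 1 - A 0 1 * A 1 0.
Proof.
rewrite (expand_det_row _ 0) !big_ord_recl big_ord0 addr0 /cofactor !det_mx11 !mxE /=.
rewrite expr0 mul1r expr1 mulN1r mulrN.
by congr (A _ _ * A _ _ - A _ _ * A _ _); apply/val_inj.
Qed.

(** In the basis formed by the rows of [Y] and [f], the matrix of the twistor is block lower
    triangular, with diagonal blocks the identity and the two rows of quotient coordinates. *)
Lemma twistor_cross (R : realType) (k n : nat) (Z : 'M[R]_(n, k + 2))
    (Y : 'M[R]_(k, k + 2)) (f : 'M[R]_(2, k + 2)) (i j : 'I_n) :
  \det (col_mx Y f) != 0 ->
  twistor Z Y i j =
  cross (quotient_coord Y f (row i Z)) (quotient_coord Y f (row j Z)) *
  \det (col_mx Y f).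
Proof.
move=> dB; have Bu : col_mx Y f \in unitmx by rewrite unitmxE unitfE.
pose W : 'M[R]_(2, k + 2) := col_mx (row i Z) (row j Z) *m invmx (col_mx Y f).
have -> : cross (quotient_coord Y f (row i Z)) (quotient_coord Y f (row j Z)) =
    \det (rsubmx W).
  have W0 l : rsubmx W 0 l = quotient_coord Y f (row i Z) 0 l.
    rewrite /W (@mul_col_mx _ 1 1) [LHS]mxE [RHS]mxE.
    rewrite -(col_mxEu _ (row j Z *m invmx (col_mx Y f))).
    by congr (col_mx _ _ _ _); apply/val_inj.
  have W1 l : rsubmx W 1 l = quotient_coord Y f (row j Z) 0 l.
    rewrite /W (@mul_col_mx _ 1 1) [LHS]mxE [RHS]mxE.
    rewrite -(col_mxEd (row i Z *m invmx (col_mx Y f))).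
    by congr (col_mx _ _ _ _); apply/val_inj.
  by rewrite det_mx2 !W0 !W1.
rewrite -[\det (rsubmx W)]mul1r -(det1 R k) -(det_lblock _ (lsubmx W)) -det_mulmx.
congr (\det _); rewrite /block_mx mul_col_mx mul_row_col mul1mx mul0mx addr0.
by rewrite hsubmxK mulmxKV.
Qed.

(** The cross product with a fixed [u] is a linear form in the row of [Z]; its values thus lie in
    the column span, where the bound on alternations applies. *)
Lemma cross_quotient_coord (R : realType) (k n : nat) (Z : 'M[R]_(n, k + 2))
    (Y : 'M[R]_(k, k + 2)) (f : 'M[R]_(2, k + 2)) (u : 'rV[R]_2) :
  exists x : 'cV[R]_(k + 2),
    forall i, (Z *m x) i 0 = cross u (quotient_coord Y f (row i Z)).
Proof.
pose P := rsubmx (invmx (col_mx Y f)).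
exists (P *m (\col_j if j == 0 then - u 0 1 else u 0 0)) => i.
rewrite mulmxA mxE !big_ord_recl big_ord0 addr0 quotient_coordE -row_mul.
rewrite /cross !mxE /= addrC mulrC mulrN [X in _ - X = _]mulrC.
by congr (_ * _ - _ * _); apply: eq_bigr => l _; congr (_ * P _ _); apply/val_inj.
Qed.

(** Cramer's rule in the plane; up to sign, its coefficients become the entries of a row of the fan
    matrix. *)
Lemma cross_plucker (R : realType) (u v w : 'rV[R]_2) :
  cross v w *: u - cross u w *: v + cross u v *: w = 0.
Proof.
apply/rowP => j; rewrite !mxE /cross.
have [->|->] : j = 0 \/ j = 1 by case: j => [[|[|]]]//= ?; [left|right]; apply/val_inj.
  by ring.
by ring.
Qed.

(** Passing from [Y] to [Y' = M *m Y] multiplies every twistor by [\det M]. *)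
Lemma twistor_represents_neq0 (R : realType) (k n : nat) (Z : 'M[R]_(n, k + 2))
    (Y Y' : 'M[R]_(k, k + 2)) (V : Gr R k (k + 2)) (i j : 'I_n) :
  represents Y V -> represents Y' V -> twistor Z Y' i j != 0 ->
  twistor Z Y i j != 0.
Proof.
move=> YV Y'V; have /choice[L YL] : forall r, exists l : 'rV_k, row r Y' = l *m Y.
  move=> r; apply: mem_represents YV _.
  by rewrite rowE; exact: represents_mem.
pose M : 'M[R]_k := \matrix_r L r.
have -> : Y' = M *m Y by apply/row_matrixP => r; rewrite row_mul rowK YL.
apply: contra => /eqP t0; apply/eqP; rewrite /twistor.
set W := col_mx (row i Z) _.
have -> : col_mx (M *m Y) W = block_mx M 0 0 1%:M *m col_mx Y W.
  by rewrite /block_mx mul_col_mx !mul_row_col !mul0mx mul1mx addr0 add0r.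
by rewrite det_mulmx -/(twistor Z Y i j) t0 mulr0.
Qed.

(** * The bound on the winding number and the extremal case *)

Lemma winding_angles (R : realType) (k n : nat) (Z : 'M[R]_(n.+1, k + 2))
    (Y : 'M[R]_(k, k + 2)) (w : int) :
  is_winding_number Z Y w -> (forall i, twistor Z Y i (ordS i) != 0) ->
  exists2 f : 'M[R]_(2, k + 2), 0 < \det (col_mx Y f) &
  let z (i : 'I_n.+1) := quotient_coord Y f (row i Z) in
  exists phi : nat -> R,
    [/\ phi 0%N = 0, phi n.+1 = 2 * pi * w%:~R,
      forall i : 'I_n.+1, `|phi i.+1 - phi i| < pi,
      forall i : 'I_n.+1, exists2 r, 0 < r &
        cross (z i) (z (ordS i)) = r * sin (phi i.+1 - phi i)
    & forall i : 'I_n.+1, exists2 r, 0 < r & cross (z ord0) (z i) = r * sin (phi i)].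
Proof.
move=> [f [df [gamma hg hw]]] tn0; exists f => //=.
apply: (polygon_angles hg hw) => i.
have := tn0 i; rewrite (twistor_cross _ _ _ (lt0r_neq0 df)).
by rewrite mulf_eq0 negb_or => /andP[].
Qed.

Lemma winding_number_le (R : realType) (k n : nat) (Z : 'M[R]_(n.+1, k + 2))
    (Y : 'M[R]_(k, k + 2)) (w : int) :
  Mat_pos Z -> (forall i, twistor Z Y i (ordS i) != 0) ->
  is_winding_number Z Y w -> w <= ((k + 1)./2)%:Z.
Proof.
move=> hZ tn0 /winding_angles/(_ tn0)[f df [phi [phi0 phin step _ crossE]]].
rewrite leNgt; apply/negP => wk.
(* Twice [(k + 1)./2] is at least [k], and [w] exceeds [(k + 1)./2] by at least one. *)
have kw : (k + 2)%:R <= 2 * w%:~R :> R.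
  rewrite -[2]/(2%:~R) -intrM -[(k + 2)%:R]/((k + 2)%:Z%:~R) ler_int; lia.
have pi0 := pi_gt0 R.
have KN : k.+1%:R * pi <= phi n.
  have := step ord_max; rewrite /= ltr_norml phin => /andP[_ h].
  have : (k + 2)%:R * pi <= 2 * w%:~R * (pi : R) by rewrite ler_pM2r.
  rewrite addn2 -[k.+2%:R]natr1 mulrDl mul1r; lra.
have stepN i : (i < n)%N -> phi i.+1 - phi i < pi.
  move=> i_n; have := step (Ordinal (leqW i_n)).
  by rewrite /= ltr_norml => /andP[].
have [j [jP jmono]] := first_passage pi0 phi0 stepN KN.
(* The [k + 3] indices are [0], [(j 1).-1], [j 1], ..., [j k.+1], numbered from [0]. *)
pose gn (i : nat) : nat :=
  if i is i'.+1 then if i' is m.+1 then j m.+1 else (j 1%N).-1 else 0%N.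
have [/andP[j1 j1n] _ /andP[phi1 phi1']] := jP 1%N isT.
rewrite /= mul0r mul1r in phi1 phi1'.
have j10 : (0 < (j 1%N).-1)%N.
  by rewrite lt0n; apply/eqP => j10; move: phi1; rewrite j10 phi0 ltxx.
have jK m : (m < k.+1)%N -> (0 < j m.+1 <= n)%N by move=> mk; have [] := jP m.+1 mk.
have gnn i : (i < (k + 2).+1)%N -> (gn i <= n)%N.
  case: i => [|[|m]] //= mk; first by lia.
  by have /andP[] := jK m (ltac:(lia)).
have gnm a b : (a < b)%N -> (b < (k + 2).+1)%N -> (gn a < gn b)%N.
  case: b => [|[|b]] //; first by case: a => [|[|]].
  move=> ab bk; have /andP[jb _] := jK b (ltac:(lia)).
  case: a ab => [|[|a]] //= ab.
    case: b jb ab bk => [|b] jb ab bk; first by lia.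
    have := jmono 1%N b.+2 isT (ltac:(lia)); lia.
  have := jmono a.+1 b.+1 (ltac:(lia)) (ltac:(lia)); lia.
pose g (i : 'I_(k + 2).+1) : 'I_n.+1 := inord (gn i).
have gE i : g i = gn i :> nat by rewrite inordK// ltnS gnn.
have [x xE] := cross_quotient_coord Z Y f (quotient_coord Y f (row ord0 Z)).
have crossg i : exists2 r, 0 < r & (Z *m x) (g i) 0 = r * sin (phi (gn i)).
  by have [r r0 rE] := crossE (g i); exists r => //; rewrite xE rE gE.
have i1 : (1 < (k + 2).+1)%N by lia.
(* The sine is positive at position [1], where the alternation pattern wants a negative value, hence
   [- x]. The vanishing there contradicts [0 < phi (j 1).-1 < pi]. *)
have /(_ (Ordinal i1)) : forall i, (Z *m (- x)) (g i) 0 = 0.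
  apply: alternating_col_span_eq0 => // [a b ab|i]; first by rewrite !gE gnm.
  have [r r0 rE] := crossg i.
  rewrite mulmxN mxE rE; case: i {rE} => [[|[|m]]] mk /=.
  - by rewrite phi0 sin0 mulr0 oppr0 mulr0.
  - by rewrite expr1 mulN1r opprK mulr_ge0 ?ltW// sin_gt0_pi// phi1.
  - rewrite exprS mulN1r mulrNN mulrCA; apply: (mulr_ge0 (ltW r0)).
    by apply: sin_sign_ge0; have [] := jP m.+1 (ltac:(lia)).
have [r r0 rE] := crossg (Ordinal i1); rewrite mulmxN mxE rE => /eqP.
by rewrite oppr_eq0 gt_eqF// mulr_gt0// sin_gt0_pi//= phi1.
Qed.

Lemma winding_number_max_mem (R : realType) (k n : nat) (Z : 'M[R]_(n.+1, k + 2))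
    (Y : 'M[R]_(k, k + 2)) (V : Gr R k (k + 2)) :
  (k + 2 <= n.+1)%N -> Mat_pos Z -> represents Y V ->
  (forall i, twistor Z Y i (ordS i) != 0) ->
  is_winding_number Z Y ((k + 1)./2)%:Z ->
  coarse_boundary_conditions Z Y -> amplituhedron Z V.
Proof.
move=> kn hZ YV tn0 /winding_angles/(_ tn0).
move=> [f df [phi [phi0 phin step stepE crossE]]] [cb cbn].
set z := fun i => quotient_coord Y f (row i Z) in stepE crossE.
have pi0 := pi_gt0 R.
have tE i j : twistor Z Y i j = cross (z i) (z j) * \det (col_mx Y f).
  exact: twistor_cross (lt0r_neq0 df).
(* For odd [k] the total angle is [(k + 1) * pi] and the closing edge takes less than [pi] of it.
   For even [k] the total is [k * pi], and the coarse condition on the closing edge forbids a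
   positive last turn. *)
have KN : k%:R * pi <= phi n.
  have := step ord_max; rewrite /= ltr_norml => /andP[h1 h2].
  have [ko|ke] := boolP (odd k).
    have kE : 2 * (((k + 1)./2)%:Z%:~R : R) = k%:R + 1.
      by rewrite natr1 -natrM; congr (_%:R); lia.
    move: h2; rewrite phin mulrAC kE; lra.
  have kE : 2 * (((k + 1)./2)%:Z%:~R : R) = k%:R.
    by rewrite -natrM; congr (_%:R); lia.
  have [r r0 rE] := stepE ord_max.
  have : cross (z ord_max) (z (ordS ord_max)) <= 0.
    have := cbn ord_max erefl; rewrite addn1 exprS -signr_odd (negbTE ke) mulr1 mulN1r.
    by rewrite oppr_ge0 tE pmulr_lle0.
  rewrite rE pmulr_rle0//= => sn.
  rewrite leNgt; apply/negP => lt1.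
  have : 0 < sin (phi n.+1 - phi n).
    apply: sin_gt0_pi; rewrite h2 andbT phin mulrAC kE; lra.
  by rewrite ltNge sn.
have stepN i : (i < n)%N -> phi i.+1 - phi i < pi.
  move=> i_n; have := step (Ordinal (leqW i_n)).
  by rewrite /= ltr_norml => /andP[].
have [j [jP jmono]] := first_passage pi0 phi0 stepN KN.
(* Rows are numbered from [0]: row [r] uses the passage of [(r + 1) * pi]. *)
pose p r := (j r.+1).-1; pose s r := j r.+1.
pose zn i := z (inord i).
have hjP r : (r < k)%N -> [/\ (0 < s r <= n)%N, r.+1%:R * pi <= phi (s r) < r.+2%:R * pi
    & r%:R * pi < phi (p r) < r.+1%:R * pi] by move=> rk; exact: jP.
have hps : interlacing k p s.
  split => [r rk|r r' rr' r'k]; last by apply: jmono => //; lia.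
  have [/andP[s0 _] _ /andP[ph _]] := hjP r rk.
  rewrite /p /s in s0 ph *; rewrite prednK// leqnn andbT lt0n; apply/eqP => j0.
  by move: ph; rewrite j0 phi0 ltNge mulr_ge0// ltW.
have sn r : (r < k)%N -> (s r < n.+1)%N by move=> /hjP[/andP[]].
have pn r : (r < k)%N -> (p r < n.+1)%N.
  by move=> rk; have /andP[_] := hps.1 r rk; have := sn r rk; lia.
pose a r := cross (zn (p r)) (zn (s r)).
pose b r := (-1) ^+ r.+1 * cross (z ord0) (zn (s r)).
pose c r := (-1) ^+ r * cross (z ord0) (zn (p r)).
apply: (fan_amplituhedron (p := p) (s := s) (a := a) (b := b) (c := c)) => //.
(* Since [s r <= n], the edge from [p r] to [s r] is not the closing one, and its twistor is
   nonnegative by the coarse conditions. *)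
- move=> r rk; have sE : inord (s r) = ordS (inord (p r)) :> 'I_n.+1.
    apply/val_inj; rewrite /= !inordK ?sn ?pn//.
    by have [/andP[s0 s1] _ _] := hjP r rk; rewrite /p prednK// modn_small.
  rewrite /a /zn sE; have := cb (inord (p r)).
  rewrite tE pmulr_lge0//; apply; rewrite inordK ?pn//.
  by have [/andP[s0 s1] _ _] := hjP r rk; rewrite /p prednK.
- move=> r rk; have [q q0 qE] := crossE (inord (s r)); rewrite /b /zn qE inordK ?sn//.
  rewrite mulrCA; apply: (mulr_ge0 (ltW q0)); apply: sin_sign_ge0.
  by have [] := hjP r rk.
- move=> r rk; have [q q0 qE] := crossE (inord (p r)); rewrite /c /zn qE inordK ?pn//.
  rewrite mulrCA mulr_gt0//; apply: sin_sign_gt0.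
  by have [] := hjP r rk.
- move=> r.
  rewrite (row_fan_matrix_mulmx _ _ _ _ (i0 := ord0) (ip := inord (p r))
    (is_ := inord (s r))) ?inordK ?pn ?sn//.
  set v := _ + _.
  have [l ->] : exists l : 'rV_k, v = l *m Y; last exact: represents_mem.
  apply: (quotient_coord_eq0 (lt0r_neq0 df)).
  rewrite quotient_coordE /v !mulmxDl -!scalemxAl -!quotient_coordE.
  rewrite -/(z ord0) -/(z (inord (p r))) -/(z (inord (s r))) -/(zn (p r)) -/(zn (s r)).
  have := cross_plucker (z ord0) (zn (p r)) (zn (s r)).
  (* Scaling by this sign gives the apex its signed coefficient; the minus sign of the middle term
     is the extra factor in [b r]. *)
  move=> /(congr1 (GRing.scale ((-1) ^+ r))); rewrite scaler0 => <-.
  rewrite /a /b /c !scalerDr scalerN !scalerA exprS mulN1r !mulNr scaleNr.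
  by [].
Qed.

Theorem proposition1p16 (R : realType) (k n : nat) (hn : (k + 2 <= n)%N)
    (Z : 'M[R]_(n, k + 2)) (hZ : Mat_pos Z)
    (V : Gr R k (k + 2)) (hV : Gr_wcb Z V) :
  (forall Y : 'M[R]_(k, k + 2), represents Y V ->
     winding_number Z Y <= ((k + 1)./2)%:Z) /\
  (forall Y : 'M[R]_(k, k + 2), represents Y V ->
     winding_number Z Y = ((k + 1)./2)%:Z ->
     coarse_boundary_conditions Z Y ->
     amplituhedron Z V).
Proof.
case: n Z hn hZ hV => [|n] Z hn hZ [Y0 Y0V tY0]; first by rewrite addn2 in hn.
have tn0 Y : represents Y V -> forall i, twistor Z Y i (ordS i) != 0.
  by move=> YV i; apply: twistor_represents_neq0 YV Y0V (tY0 i).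
split => Y YV; rewrite /winding_number; case: xgetP.
- by move=> w _ hw; apply: winding_number_le hw => //; exact: tn0.
- by [].
- move=> w -> hw wE cb; rewrite wE in hw.
  by apply: winding_number_max_mem hw cb => //; exact: tn0.
(* Without a winding number the default value [0] can equal [(k + 1)./2] only for [k = 0]; the fan
   matrix then has no rows and the conditions on them are vacuous. *)
- move=> _ k0 _; have {}k0 : k = 0%N by lia.
  subst k; apply: (fan_amplituhedron (p := id) (s := id) (a := fun=> 0)
    (b := fun=> 0) (c := fun=> 0)) => //; last by case.
Qed.
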